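(* Let $G=(\mathbf{N},\{X_i\}_{i\in\mathbf{N}},\{f_i\}_{i\in\mathbf{N}})$ be a noncooperative interval-valued game, with $V=\prod_{i\in\mathbf{N}}X_i$ and with $f:V\times V\to\mathcal{I}$ defined by $f(x,y)=\sum_{i=1}^n\big(f_i(y_i,x_{-i})\ominus_{gH}f_i(x_i,x_{-i})\big)$. Suppose that (i) for each $i\in\mathbf{N}$ and $x_{-i}\in V_{-i}$, $f_i(\cdot,x_{-i})$ is $\preccurlyeq$-lower semicontinuous and $\preccurlyeq$-lower bounded on $X_i$; (ii) for any $x,y,z\in V$, $f(x,z)\preccurlyeq f(x,y)+f(y,z)$. Then for any given $\varepsilon>0$, $G$ admits an $\varepsilon$-Nash equilibrium.
   Context: $\mathcal{I}=\{[a,b]:a\le b,\ a,b\in\mathbb{R}\}$ is the set of closed bounded real intervals. For $A=[\underline{a},\overline{a}]$, $B=[\underline{b},\overline{b}]$ in $\mathcal{I}$: $A+B=[\underline{a}+\underline{b},\overline{a}+\overline{b}]$; the $gH$-difference is $A\ominus_{gH}B=[\min\{\underline{a}-\underline{b},\overline{a}-\overline{b}\},\max\{\underline{a}-\underline{b},\overline{a}-\overline{b}\}]$; $A\preccurlyeq B$ means $\underline{a}\le\underline{b}$ and $\overline{a}\le\overline{b}$; $A\prec B$ means $\underline{a}<\underline{b}$ and $\overline{a}<\overline{b}$, and $\not\prec$ is its negation. For a metric space $X$, $g:X\to\mathcal{I}$ is $\preccurlyeq$-lower semicontinuous if for every $A\in\mathcal{I}$ the set $\{x\in X:g(x)\preccurlyeq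 A\}$ is closed, and $\preccurlyeq$-lower bounded if there is $A\in\mathcal{I}$ with $A\preccurlyeq g(x)$ for all $x\in X$. The game: $\mathbf{N}=\{1,\dots,n\}$ is the set of players; for each $i\in\mathbf{N}$ the strategy set $X_i$ is a (nonempty) complete metric space with metric $d_i$; $V=\prod_{i\in\mathbf{N}}X_i$; $f_i:V\to\mathcal{I}$ is the interval-valued loss function of player $i$. $V_{-i}=\prod_{j\in\mathbf{N}\setminus\{i\}}X_j$; for $x=(x_1,\dots,x_n)\in V$, $x_{-i}=(x_1,\dots,x_{i-1},x_{i+1},\dots,x_n)\in V_{-i}$ and, for $y_i\in X_i$, $(y_i,x_{-i})=(x_1,\dots,x_{i-1},y_i,x_{i+1},\dots,x_n)\in V$. Given $\varepsilon>0$, $\overline{x}\in V$ is an $\varepsilon$-Nash equilibrium of $G$ if for each $i\in\mathbf{N}$ and all $y_i\in X_i$, $f_i(y_i,\overline{x}_{-i})+[\varepsilon d_i(\overline{x}_i,y_i),\varepsilon d_i(\overline{x}_i,y_i)]\not\prec f_i(\overline{x}_i,\overline{x}_{-i})$. *)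

(* Defs.v *)
From HB Require Import structures.
From mathcomp Require Import all_boot all_order all_algebra.
From mathcomp Require Import all_classical all_reals all_analysis.

Set Implicit Arguments.
Unset Strict Implicit.
Unset Printing Implicit Defensive.

Import Order.TTheory GRing.Theory Num.Theory.

Local Open Scope classical_set_scope.
Local Open Scope ring_scope.

Reserved Notation "A ⊖ B" (at level 50, left associativity).
Reserved Notation "A ≼ B" (at level 70, no associativity).
Reserved Notation "A ≺ B" (at level 70, no associativity).

(* Every [completeType] is pointed, hence a complete metric space in this sense
   is nonempty. *)
#[short(type="completeMetricType")]
HB.structure Definition CompleteMetric (R : numDomainType) :=
  {T of CompletePseudoMetric R T & Metric R T}.

Definition ordered_ends (R : realType) : {pred R * R} := fun p => p.1 <= p.2.

(* A compact interval [a, b] is represented by the pair of its endpoints. *)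
Record cinterval (R : realType) := CInterval {
  endpoints : R * R;
  endpointsP : ordered_ends endpoints }.

HB.instance Definition _ (R : realType) :=
  [isSub for @endpoints R].
HB.instance Definition _ (R : realType) := [Choice of cinterval R by <:].

Lemma ordered_ends_addr_closed (R : realType) :
  GRing.nmod_closed (@ordered_ends R).
Proof.
split=> [|p q]; rewrite !unfold_in /ordered_ends /=; first exact: lexx.
exact: lerD.
Qed.

(* Addition of intervals is inherited from R * R, i.e. it is endpointwise. *)
HB.instance Definition _ (R : realType) :=
  GRing.SubChoice_isSubNmodule.Build (R * R)%type (@ordered_ends R)
    (cinterval R) (ordered_ends_addr_closed R).

Section Interval.
Context {R : realType}.
Implicit Types A B : cinterval R.

Definition lo A : R := (endpoints A).1.
Definition hi A : R := (endpoints A).2.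

Definition mk_cinterval (a b : R) (ab : a <= b) : cinterval R :=
  @CInterval R (a, b) ab.

(* The degenerate interval [c, c]. *)
Definition ipoint (c : R) : cinterval R := mk_cinterval (lexx c).

Lemma ghsub_subproof A B :
  Num.min (lo A - lo B) (hi A - hi B) <= Num.max (lo A - lo B) (hi A - hi B).
Proof. by rewrite ge_min le_max lexx. Qed.

Definition ghsub A B : cinterval R := mk_cinterval (ghsub_subproof A B).

Definition ile A B : bool := (lo A <= lo B) && (hi A <= hi B).
Definition ilt A B : bool := (lo A < lo B) && (hi A < hi B).

Lemma lo0 : lo 0 = 0. Proof. by []. Qed.
Lemma hi0 : hi 0 = 0. Proof. by []. Qed.
Lemma loD A B : lo (A + B) = lo A + lo B. Proof. by []. Qed.
Lemma hiD A B : hi (A + B) = hi A + hi B. Proof. by []. Qed.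

End Interval.

Notation "A ⊖ B" := (ghsub A B) : ring_scope.
Notation "A ≼ B" := (ile A B) : ring_scope.
Notation "A ≺ B" := (ilt A B) : ring_scope.

Definition ilower_semicontinuous {R : realType} {X : topologicalType}
    (g : X -> cinterval R) : Prop :=
  forall A : cinterval R, closed [set x | g x ≼ A].

Definition ilower_bounded {R : realType} {X : Type}
    (g : X -> cinterval R) : Prop :=
  exists A : cinterval R, forall x, A ≼ g x.

(* The player set is 'I_n and V is the type of dependent functions
   [forall i, X i].  The profile (y_i, x_{-i}) is [dfwith x i y_i]; it does not
   depend on the i-th coordinate of x.  As the X i are nonempty, every x_{-i}
   comes from some x, so x_{-i} is quantified over by means of x. *)
Definition profile {R : realType} {n : nat} (X : 'I_n -> completeMetricType R)
  : Type := forall i, X i.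

Definition losses {R : realType} {n : nat} (X : 'I_n -> completeMetricType R)
  : Type := 'I_n -> profile X -> cinterval R.

Definition game_bifunction {R : realType} {n : nat}
    {X : 'I_n -> completeMetricType R} (loss : losses X)
    (x y : profile X) : cinterval R :=
  \sum_(i < n) (loss i (dfwith x i (y i)) ⊖ loss i x).

Definition eps_Nash_equilibrium {R : realType} {n : nat}
    {X : 'I_n -> completeMetricType R} (loss : losses X) (eps : R)
    (xbar : profile X) : Prop :=
  forall (i : 'I_n) (y : X i),
    ~~ (loss i (dfwith xbar i y) + ipoint (eps * mdist (xbar i) y)
          ≺ loss i xbar).

(* Main.v *)
Require Import Defs.
From mathcomp Require Import all_boot all_order all_algebra.
From mathcomp Require Import all_classical all_reals all_analysis.
From mathcomp Require Import lra.

Import Order.TTheory GRing.Theory Num.Theory.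

(** The upper endpoint of the game bifunction already controls both endpoints
of every loss.  By definition of the gH-difference,
  hi (A ⊖ B) = max (lo A - lo B) (hi A - hi B),
so hi (A ⊖ B) + c < 0 holds exactly when both endpoints of A + [c, c] lie
strictly below those of B.  Hence it suffices to apply an Ekeland variational
principle to the real bifunction
  F x y = hi (game_bifunction loss x y)
        = sum over i of hi (loss i (dfwith x i (y i)) ⊖ loss i x):
it produces a profile xbar with F xbar y + eps * d xbar y > 0 for all
y <> xbar, where d is the sum of the coordinate distances.  Testing this on a
unilateral deviation y = dfwith xbar i t kills every term but the i-th one, and
what remains says precisely that the i-th player cannot improve.

Ekeland's principle is applicable because F inherits the triangle inequality
from the game bifunction, and because in each variable y i the i-th summand is
bounded below and lower semicontinuous.  The last point
([lower_semicontinuous_hi_ghsub]) needs some care: interval lower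
semicontinuity of A does not make the function lo A lower semicontinuous (hi A
may blow up along a sequence on which lo A stays small), but the sublevel sets
of hi (A ⊖ B) for a fixed B are interval sublevel sets of A.

The variational principle is split into an order-theoretic part
([ekeland_sequence]), which builds a descending sequence for the relation
F x y + D x y <= 0 whose tails have vanishing D-radius, and a topological part
([ekeland_product]), where completeness of each factor gives the limit. *)

Local Open Scope classical_set_scope.
Local Open Scope ring_scope.

(** * Ekeland's variational principle for bifunctions on a finite product *)

(** The relation F x y + D x y <= 0 is a preorder by the two triangle
inequalities.  Going down to a point y that almost minimizes F x among the
successors of x leaves little room below: a successor z of y is also one of x,
so D y z <= - F y z <= F x y - F x z is at most the defect of minimality, here
chosen to be the harmonic sequence. *)
Lemma ekeland_sequence (R : realType) (V : Type) (F D : V -> V -> R) (x0 : V)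
    (F_triangle : forall x y z, F x z <= F x y + F y z)
    (D_triangle : forall x y z, D x z <= D x y + D y z)
    (FD_refl : forall x, F x x + D x x <= 0)
    (F_bounded : forall x, exists c, forall y, c <= F x y) :
  exists u : nat -> V, forall k m : nat,
    [/\ (k <= m)%N -> F (u k) (u m) + D (u k) (u m) <= 0
      & forall y, F (u k.+1) y + D (u k.+1) y <= 0 ->
                  D (u k.+1) y <= harmonic k].
Proof.
have FD_trans x y z : F x y + D x y <= 0 -> F y z + D y z <= 0 ->
    F x z + D x z <= 0.
  move=> xy yz; have := F_triangle x y z; have := D_triangle x y z; lra.
have /choice[step stepP] (p : nat * V) : exists y,
    F p.2 y + D p.2 y <= 0 /\
    forall z, F y z + D y z <= 0 -> D y z <= harmonic p.1.
  case: p => k x /=; have [c cF] := F_bounded x.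
  pose E := F x @` [set y | F x y + D x y <= 0].
  have E_inf : has_inf E.
    split; first by exists (F x x), x => //=; exact: FD_refl.
    by exists c => _ [y _ <-]; exact: cF.
  have [_ [y xy <-] yinf] := inf_adherent (harmonic_gt0 (R := R) k) E_inf.
  exists y; split=> // z yz.
  have infz : inf E <= F x z.
    apply: ge_inf; first by case: E_inf.
    by exists z => //=; exact: FD_trans yz.
  suff : D y z <= harmonic k by [].
  have := F_triangle x y z; lra.
pose u := nat_rect (fun _ => V) x0 (fun k x => step (k, x)).
exists u => k m; split.
  elim: m => [|m IHm]; first by rewrite leqn0 => /eqP ->; exact: FD_refl.
  rewrite leq_eqVlt => /orP[/eqP -> | /IHm km]; first exact: FD_refl.
  by apply: FD_trans km _; exact: (stepP (m, u m)).1.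
exact: (stepP (k, u k)).2.
Qed.

Lemma harmonic_lt (R : realType) (e : R) : 0 < e ->
  exists k : nat, forall m : nat, (k <= m)%N -> harmonic m < e.
Proof.
move=> e0; have /cvgrPdist_lt/(_ e e0) [k _ kP] := @cvg_harmonic R.
exists k => m km; have := kP m km.
by rewrite sub0r normrN ger0_norm // harmonic_ge0.
Qed.

Lemma cvg_le_harmonic (R : realType) (T : metricType R) (v : nat -> T) (z : T)
    (eps : R) (eps_gt0 : 0 < eps)
    (vz : forall k : nat, eps * mdist (v k.+1) z <= harmonic k) :
  v @ \oo --> z.
Proof.
apply/(@metricType_numDomainType.cvgrPdist_lt R T) => e e0.
have [k kP] := harmonic_lt R (eps * e) (mulr_gt0 eps_gt0 e0).
exists k.+1 => //= -[//|m] km.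
by rewrite metric_sym -(ltr_pM2l eps_gt0) (le_lt_trans (vz m)) // kP.
Qed.

Lemma is_cvg_le_harmonic (R : realType) (T : completeMetricType R)
    (v : nat -> T) (eps : R) (eps_gt0 : 0 < eps)
    (v_small : forall k m : nat, (k < m)%N ->
       eps * mdist (v k.+1) (v m) <= harmonic k) :
  cvg (v @ \oo).
Proof.
apply: cauchy_cvg; apply: cauchy_exP => e e0.
have [k kP] := harmonic_lt R (eps * e) (mulr_gt0 eps_gt0 e0).
exists (v k.+1), k.+1 => //= m km.
rewrite ballEmdist /= -(ltr_pM2l eps_gt0).
by rewrite (le_lt_trans (v_small k m km)) // kP.
Qed.

Lemma lower_semicontinuousD (R : realType) (T : topologicalType) (f g : T -> R) :
  lower_semicontinuous (EFin \o f) -> lower_semicontinuous (EFin \o g) ->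
  lower_semicontinuous (EFin \o (f \+ g)).
Proof.
move=> lf lg x a; rewrite /= lte_fin => afg.
pose d := (f x + g x - a) / 2.
have [|A xA Af] := lf x (f x - d); first by rewrite lte_fin /d; lra.
have [|B xB Bg] := lg x (g x - d); first by rewrite lte_fin /d; lra.
exists (A `&` B); first exact: filterI.
move=> y [/Af + /Bg]; rewrite /= !lte_fin /d; lra.
Qed.

Lemma lower_semicontinuous_mdist (R : realType) (T : metricType R) (eps : R)
    (x : T) : 0 < eps ->
  lower_semicontinuous (fun y => (eps * mdist x y)%:E).
Proof.
move=> eps0 z a; rewrite lte_fin => az.
have xz0 : 0 < mdist x z - a / eps by rewrite subr_gt0 ltr_pdivrMr // mulrC.
exists (ball z (mdist x z - a / eps)); first exact: nbhsx_ballx.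
move=> y; rewrite ballEmdist /= => zy; rewrite lte_fin.
rewrite mulrC -ltr_pdivrMr //.
by have := metric_triangle x y z; rewrite (metric_sym y z); lra.
Qed.

(** Sequential lower semicontinuity of a separable sum on a product; the product
topology itself is avoided, coordinatewise convergence being all there is to
use. *)
Lemma sum_lower_semicontinuous_le (R : realType) (n : nat)
    (X : 'I_n -> topologicalType) (h : forall i, X i -> R)
    (v : nat -> forall i, X i) (z : forall i, X i) (c : R)
    (lsc_h : forall i, lower_semicontinuous (EFin \o h i))
    (vz : forall i, (fun m => v m i) @ \oo --> z i)
    (vc : \forall m \near \oo, \sum_(i < n) h i (v m i) <= c) :
  \sum_(i < n) h i (z i) <= c.
Proof.
apply/ler_addgt0Pr => e e0.
(* n.+1 rather than n, so that d is meaningful for the empty product. *)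
pose d := e / n.+1%:R.
have d0 : 0 < d by rewrite divr_gt0.
have near_h : \forall m \near \oo, forall i, h i (z i) - d < h i (v m i).
  apply: filter_forall => i.
  have [|A zA Ah] := lsc_h i (z i) (h i (z i) - d).
    by rewrite lte_fin ltrBlDr ltrDl.
  have vA : \forall m \near \oo, A (v m i) by exact: vz i A zA.
  by apply: filterS vA => m /Ah; rewrite lte_fin.
have [m [hm sm]] := @filter_ex _ \oo _ _ (filterI near_h vc).
have : \sum_(i < n) (h i (z i) - d) <= c.
  by apply: le_trans sm; apply: ler_sum => i _; exact/ltW.
rewrite sumrB sumr_const card_ord lerBlDr => /le_trans; apply.
rewrite lerD2l -[d *+ n]mulr_natr /d mulrAC ler_pdivrMr ?ltr0n //.
by rewrite ler_pM2l // ler_nat.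
Qed.

(** The sequence of [ekeland_sequence] is Cauchy in each coordinate, and its
limit xbar is a successor of all its terms by lower semicontinuity.  A successor
y of xbar is then also a successor of all terms, hence, the radii of the tails
being vanishing, it is a limit of the same sequence: y = xbar. *)
Lemma ekeland_product (R : realType) (n : nat) (X : 'I_n -> completeMetricType R)
    (g : forall i, profile X -> X i -> R)
    (lsc_g : forall i x, lower_semicontinuous (EFin \o g i x))
    (bounded_g : forall i x, exists c, forall y, c <= g i x y)
    (g_refl : forall x, \sum_(i < n) g i x (x i) = 0)
    (g_triangle : forall x y z : profile X,
       \sum_(i < n) g i x (z i)
         <= \sum_(i < n) g i x (y i) + \sum_(i < n) g i y (z i))
    (eps : R) (eps_gt0 : 0 < eps) :
  exists xbar : profile X, forall y : profile X, y <> xbar ->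
    0 < \sum_(i < n) (g i xbar (y i) + eps * mdist (xbar i) (y i)).
Proof.
pose F (x y : profile X) := \sum_(i < n) g i x (y i).
pose D (x y : profile X) := \sum_(i < n) eps * mdist (x i) (y i).
have eps_mdist_ge0 (i : 'I_n) (s t : X i) : 0 <= eps * mdist s t.
  by rewrite mulr_ge0 ?mdist_ge0 // ltW.
have D_triangle x y z : D x z <= D x y + D y z.
  rewrite -big_split /=; apply: ler_sum => i _.
  by rewrite -mulrDr ler_pM2l // metric_triangle.
have D_coord x y i : eps * mdist (x i) (y i) <= D x y.
  by rewrite /D (bigD1 i) //= lerDl sumr_ge0.
have FD_refl x : F x x + D x x <= 0.
  rewrite /F g_refl add0r /D big1 // => i _.
  by rewrite mdistxx mulr0.
have F_bounded x : exists c, forall y, c <= F x y.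
  have /choice[c cP] i := bounded_g i x.
  by exists (\sum_(i < n) c i) => y; apply: ler_sum.
have [u uP] :=
  ekeland_sequence R (profile X) F D (fun i => point)
    g_triangle D_triangle FD_refl F_bounded.
have u_cvg i : cvg ((fun m => u m i) @ \oo).
  apply: is_cvg_le_harmonic _ _ _ _ eps_gt0 _ => k m km.
  apply: le_trans (D_coord _ _ i) _.
  by apply: (uP k m).2; apply: (uP k.+1 m).1.
pose xbar : profile X := fun i => lim ((fun m => u m i) @ \oo).
have u_xbar i : (fun m => u m i) @ \oo --> xbar i by exact: u_cvg.
have FDxbar k : F (u k) xbar + D (u k) xbar <= 0.
  rewrite -big_split.
  apply: (sum_lower_semicontinuous_le R n X
    (fun i y => g i (u k) y + eps * mdist (u k i) y) u) => // [i|].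
    apply: lower_semicontinuousD; first exact: lsc_g.
    exact: lower_semicontinuous_mdist.
  by exists k => // m km; rewrite /= big_split; apply: (uP k m).1.
exists xbar => y; apply: contra_notP => /negP.
rewrite -leNgt big_split => FDy.
have FDuy k : F (u k) y + D (u k) y <= 0.
  have := FDxbar k; have := g_triangle (u k) xbar y.
  have := D_triangle (u k) xbar y; move: FDy; rewrite /F /D /=; lra.
apply: functional_extensionality_dep => i.
apply: (cvg_unique _ _ (u_xbar i)); first exact: metric_hausdorff.
apply: cvg_le_harmonic _ _ _ _ _ eps_gt0 _ => k.
by apply: le_trans (D_coord _ _ i) _; exact: (uP k k).2.
Qed.

(** * Intervals and deviations *)

Lemma ghsub_hi_le (R : realType) (A B : cinterval R) (c : R) :
  (hi (A ⊖ B) <= c) = (lo A <= lo B + c) && (hi A <= hi B + c).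
Proof. by rewrite /hi /= ge_max !lerBlDl. Qed.

(** The set where hi (g y ⊖ B) <= a is the set where g y ≼ [lo B + a, hi B + a],
and this pair of endpoints is an interval for every a, because B is one. *)
Lemma lower_semicontinuous_hi_ghsub (R : realType) (T : topologicalType)
    (g : T -> cinterval R) (B : cinterval R) :
  ilower_semicontinuous g ->
  lower_semicontinuous (fun y => (hi (g y ⊖ B))%:E).
Proof.
move=> lsc_g; apply/lower_semicontinuousP => a.
have ab : lo B + a <= hi B + a by rewrite lerD2r; exact: endpointsP.
rewrite (_ : mkset _ = ~` [set y | g y ≼ mk_cinterval ab]).
  exact/closed_openC/lsc_g.
by apply/seteqP; split=> y /=; rewrite lte_fin ltNge ghsub_hi_le => /negP.
Qed.

Lemma dfwith_id (I : eqType) (T : I -> Type) (f : forall i, T i) (i : I) :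
  dfwith f i (f i) = f.
Proof. by apply: functional_extensionality_dep => j; case: dfwithP. Qed.

Theorem theorem4p6 (R : realType) (n : nat) (X : 'I_n -> completeMetricType R)
    (loss : losses X)
    (lsc_lb : forall (i : 'I_n) (x : profile X),
        ilower_semicontinuous (fun y : X i => loss i (dfwith x i y)) /\
        ilower_bounded (fun y : X i => loss i (dfwith x i y)))
    (triangle : forall x y z : profile X,
        game_bifunction loss x z
          ≼ game_bifunction loss x y + game_bifunction loss y z)
    (eps : R) (eps_gt0 : 0 < eps) :
  exists xbar : profile X, eps_Nash_equilibrium loss eps xbar.
Proof.
pose g i (x : profile X) (y : X i) := hi (loss i (dfwith x i y) ⊖ loss i x).
have hi_game x y : hi (game_bifunction loss x y) = \sum_(i < n) g i x (y i).
  exact: (big_morph hi hiD hi0).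
have g_id i x : g i x (x i) = 0.
  by rewrite /g dfwith_id /hi /= !subrr maxxx.
have [|i x|x|x y z|xbar xbarP] := ekeland_product R n X g _ _ _ _ eps eps_gt0.
- by move=> i x; apply: lower_semicontinuous_hi_ghsub; exact: (lsc_lb i x).1.
- have [A A_le] := (lsc_lb i x).2.
  exists (hi A - hi (loss i x)) => y.
  rewrite /g /hi /= le_max; apply/orP; right.
  by rewrite lerD2r; case/andP: (A_le y).
- by rewrite big1.
- by rewrite -!hi_game -hiD; case/andP: (triangle x y z).
exists xbar => i y; apply/negP; rewrite /ilt loD hiD => /andP[lo_lt hi_lt].
have g_lt : g i xbar y + eps * mdist (xbar i) y < 0.
  rewrite -ltrBrDr sub0r /g /hi /= gt_max.
  by move: lo_lt hi_lt; rewrite /lo /hi /= => lo_lt hi_lt; apply/andP; split; lra.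
have [dxbar|/xbarP] := pselect (dfwith xbar i y = xbar).
  have yE : y = xbar i by rewrite -[in RHS]dxbar dfwithin.
  by move: g_lt; rewrite yE g_id mdistxx mulr0 addr0 ltxx.
(* The other players keep their strategy, so only the i-th term survives. *)
rewrite (bigD1 i) //= dfwithin big1 => [|j ji].
  by rewrite addr0 ltNge (ltW g_lt).
by rewrite dfwithout 1?eq_sym // g_id mdistxx mulr0 addr0.
Qed.
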